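(* Let $n\ge2$, let $\alpha_1<\cdots<\alpha_n$ be real, and let $q=P_\beta$ ($\beta\in\mathbb R^n$) be a monic real-rooted polynomial of degree $n$ that is not a point mass. Then the roots $\gamma=\Omega(\alpha,\beta)$ are simple. The $n\times n$ matrix $E=D_1\Omega(\alpha,\beta)$ is doubly stochastic, and every entry of $E$ is strictly positive.
   Context: Finite free additive convolution: for $p(x)=\sum_{k=0}^n(-1)^ka_kx^{n-k}$ and $q(x)=\sum_{k=0}^n(-1)^kb_kx^{n-k}$ with $a_0=b_0=1$, set $(p\boxplus_n q)(x)=\sum_{k=0}^n(-1)^kc_kx^{n-k}$ with $c_k=\sum_{i+j=k}\frac{(n-i)!(n-j)!}{n!(n-k)!}a_ib_j$; it preserves real-rootedness (Walsh). $P_\alpha(x)=\prod_{i=1}^n(x-\alpha_i)$. $\Omega(\alpha,\beta)\in\mathbb R^n$ is the vector of roots of $P_\alpha\boxplus_nP_\beta$ in increasing order, real analytic in $(\alpha,\beta)$ wherever the output roots are simple. $D_1\Omega(\alpha,\beta)$ is the partial Jacobian with respect to the first argument, $E_{ij}=\partial\Omega_i/\partial\alpha_j$. A point mass is a polynomial of the form $(x-b)^n$, $b\in\mathbb R$. Doubly stochastic means nonnegative entries with all row sums and column sums equal to $1$. *)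

(* Defs.v *)
From mathcomp Require Import all_boot all_order all_algebra.
From mathcomp Require Import all_classical all_reals all_analysis.

Set Implicit Arguments.
Unset Strict Implicit.
Unset Printing Implicit Defensive.

Import Order.TTheory GRing.Theory Num.Theory.
Import numFieldNormedType.Exports.

Local Open Scope classical_set_scope.
Local Open Scope ring_scope.

(* The a_k in p = \sum_k (-1)^k a_k X^(n-k). *)
Definition signed_coef (R : realType) (n : nat) (p : {poly R}) (k : nat) : R :=
  (-1) ^+ k * p`_(n - k).

Definition ffconv_coef (R : realType) (n : nat) (p q : {poly R}) (k : nat) : R :=
  \sum_(i < k.+1)
    (((n - i)`! * (n - (k - i))`!)%N%:R / (n`! * (n - k)`!)%N%:R)
      * signed_coef n p i * signed_coef n q (k - i).

(* Finite free additive convolution of degree n; it is only meaningful when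
   p and q are monic of degree n. *)
Definition ffconv (R : realType) (n : nat) (p q : {poly R}) : {poly R} :=
  \sum_(k < n.+1) ((-1) ^+ k * ffconv_coef n p q k) *: 'X^(n - k).

Definition rootpoly (R : realType) (n : nat) (alpha : 'rV[R]_n) : {poly R} :=
  \prod_(i < n) ('X - (alpha 0 i)%:P).

Definition point_mass (R : realType) (n : nat) (p : {poly R}) : Prop :=
  exists b : R, p = ('X - b%:P) ^+ n.

Definition increasing_roots (R : realType) (n : nat) (p : {poly R})
    (gamma : 'rV[R]_n) : Prop :=
  (forall i j : 'I_n, (i <= j)%N -> gamma 0 i <= gamma 0 j)
  /\ p = rootpoly gamma.

(* At most one vector satisfies [increasing_roots p]; the default value 0 would
   only be used if the convolution were not real-rooted, which Walsh's theorem
   excludes. *)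
Definition Omega (R : realType) (n : nat) (alpha beta : 'rV[R]_n) : 'rV[R]_n :=
  xget 0 [set gamma : 'rV[R]_n |
           increasing_roots (ffconv n (rootpoly alpha) (rootpoly beta)) gamma].

(* [jacobian] acts on row vectors from the right, so its (j, i) entry is
   the derivative of the i-th output with respect to the j-th input: hence the
   transpose.  It is only meaningful where [Omega ^~ beta] is differentiable. *)
Definition D1Omega (R : realType) (n : nat) (alpha beta : 'rV[R]_n) : 'M[R]_n :=
  (jacobian (fun a : 'rV[R]_n => Omega a beta) alpha)^T.

Definition doubly_stochastic (R : realType) (n : nat) (E : 'M[R]_n) : Prop :=
  [/\ forall i j, 0 <= E i j,
      forall i, \sum_(j < n) E i j = 1
    & forall j, \sum_(i < n) E i j = 1].

(* Main.v *)
(** The convolution is bilinear and symmetric; write [T p] for the convolution of [p]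
    with the fixed [q], an operator that commutes with differentiation. With [P_j] the
    product of the [X - alpha_k] over [k <> j], implicit differentiation gives
    [E_ij = T P_j (gamma_i) / (T P)' (gamma_i)], so everything reduces to the positivity
    on the real line of the Wronskian [(T P)' * T P_j - T P * (T P_j)'].

    This Wronskian depends only on [g = P_j] and [q]. Expanding [q] over its derivative,
    [q = (X - mu) h - \sum w_y h / (X - y)] with [h = q' / n] and positive weights [w_y],
    it equals [U ^ 2 + \sum w_y W_y], where [U] is the convolution of [g] and [h] in
    degree [n - 1] and [W_y] is the Wronskian in degree [n - 1] attached to [h / (X - y)]
    in the role of [g] and [g] in the role of [q]: this is an induction on [n].
    Positivity also makes [T P] interlace [T P_j], hence real-rooted with simple roots,
    again by induction. Row sums are [T P' = (T P)'], column sums are Lagrange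
    interpolation of [T P_j] at the roots of [T P].

    Differentiability uses [gamma_i(a) = gamma_i - N_i(a) / M_i(a)], where [N_i(a)] is the
    value at [gamma_i] of the convolution for [a], polynomial in [a] and zero at [alpha],
    and [M_i(a)] is the product of the [gamma_i - gamma_k(a)] over [k <> i], for which
    continuity is enough. *)
Require Import Defs.
From mathcomp Require Import all_boot all_order all_algebra.
From mathcomp Require Import all_classical all_reals all_analysis.
From mathcomp Require Import complex.
From mathcomp Require Import zify ring lra.
Set Implicit Arguments.
Unset Strict Implicit.
Unset Printing Implicit Defensive.
Import Order.TTheory GRing.Theory Num.Theory.
Import numFieldNormedType.Exports.
Local Open Scope classical_set_scope.
Local Open Scope ring_scope.

(** * Algebra of the convolution *)

(** The signs in [ffconv] and in the two [signed_coef] cancel, which leaves plain coefficients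
    indexed by the degree [l = n - k]. *)
Lemma coef_ffconv (R : realType) (n : nat) (p q : {poly R}) (l : nat) :
  (ffconv n p q)`_l = if (l <= n)%N then
    \sum_(i < (n - l).+1) ((n - i)`! * (l + i)`!)%N%:R / (n`! * l`!)%N%:R
      * p`_(n - i) * q`_(l + i) else 0.
Proof.
rewrite /ffconv coef_sum; case: leqP => hl; last first.
  apply: big1 => k _; rewrite coefZ coefXn.
  by rewrite gtn_eqF ?mulr0// (leq_ltn_trans (leq_subr _ _)).
have hk : (n - l < n.+1)%N by rewrite ltnS leq_subr.
rewrite (bigD1 (Ordinal hk)) //= big1 ?addr0; last first.
  move=> k /eqP hkl; rewrite coefZ coefXn; case: eqP => [e|]; last by rewrite mulr0.
  by case: hkl; apply: val_inj => /=; rewrite e subKn // -ltnS.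
rewrite coefZ coefXn subKn // eqxx mulr1 /ffconv_coef mulr_sumr.
apply: eq_bigr => i _; rewrite /signed_coef.
have hi : (i <= n - l)%N by rewrite -ltnS.
have -> : (n - (n - l - i) = l + i)%N.
  by rewrite subnA ?leq_subr // subKn.
have e : (-1) ^+ (n - l) = (-1) ^+ i * (-1) ^+ (n - l - i) :> R.
  by rewrite -exprD subnKC.
have s1 k : (-1) ^+ k * (-1) ^+ k = 1 :> R by rewrite -exprMn mulrNN mulr1 expr1n.
rewrite e subKn //; set a := (-1) ^+ i; set b := (-1) ^+ _; set c := _ / _.
transitivity ((a * a) * (b * b) * (c * p`_(n - i) * q`_(l + i))); first by ring.
by rewrite !s1 !mul1r.
Qed.

Lemma ffconvC (R : realType) (n : nat) (p q : {poly R}) :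
  ffconv n p q = ffconv n q p.
Proof.
apply/polyP => l; rewrite !coef_ffconv; case: leqP => // hl.
rewrite (reindex_inj rev_ord_inj) /=; apply: eq_bigr => i _.
have hi : (i <= n - l)%N by rewrite -ltnS.
rewrite subSS; have -> : (n - (n - l - i) = l + i)%N.
  by rewrite subnA ?leq_subr // subKn.
have -> : (l + (n - l - i) = n - i)%N.
  by rewrite addnBA // subnKC.
by rewrite mulnC; ring.
Qed.

Lemma ffconvDl (R : realType) (n : nat) (p1 p2 q : {poly R}) :
  ffconv n (p1 + p2) q = ffconv n p1 q + ffconv n p2 q.
Proof.
apply/polyP => l; rewrite coefD !coef_ffconv; case: leqP => // hl; last by rewrite addr0.
by rewrite -big_split; apply: eq_bigr => i _; rewrite coefD /=; ring.
Qed.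

Lemma ffconvZl (R : realType) (n : nat) (c : R) (p q : {poly R}) :
  ffconv n (c *: p) q = c *: ffconv n p q.
Proof.
apply/polyP => l; rewrite coefZ !coef_ffconv; case: leqP => // hl; last by rewrite mulr0.
by rewrite mulr_sumr; apply: eq_bigr => i _; rewrite coefZ; ring.
Qed.

Lemma ffconvDr (R : realType) (n : nat) (p q1 q2 : {poly R}) :
  ffconv n p (q1 + q2) = ffconv n p q1 + ffconv n p q2.
Proof. by rewrite ffconvC ffconvDl !(ffconvC _ p). Qed.

Lemma ffconvZr (R : realType) (n : nat) (c : R) (p q : {poly R}) :
  ffconv n p (c *: q) = c *: ffconv n p q.
Proof. by rewrite ffconvC ffconvZl ffconvC. Qed.

Lemma ffconvNl (R : realType) (n : nat) (p q : {poly R}) :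
  ffconv n (- p) q = - ffconv n p q.
Proof. by rewrite -scaleN1r ffconvZl scaleN1r. Qed.

Lemma ffconvNr (R : realType) (n : nat) (p q : {poly R}) :
  ffconv n p (- q) = - ffconv n p q.
Proof. by rewrite ffconvC ffconvNl ffconvC. Qed.

Lemma ffconv_suml (R : realType) (n : nat) (I : Type) (r : seq I)
    (P : I -> {poly R}) (q : {poly R}) :
  ffconv n (\sum_(i <- r) P i) q = \sum_(i <- r) ffconv n (P i) q.
Proof.
elim: r => [|i r IHr]; last by rewrite !big_cons ffconvDl IHr.
by rewrite !big_nil -(scale0r (0 : {poly R})) ffconvZl !scale0r.
Qed.

Lemma ffconv_sumr (R : realType) (n : nat) (I : Type) (r : seq I)
    (p : {poly R}) (Q : I -> {poly R}) :
  ffconv n p (\sum_(i <- r) Q i) = \sum_(i <- r) ffconv n p (Q i).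
Proof. by rewrite ffconvC ffconv_suml; apply: eq_bigr => i _; rewrite ffconvC. Qed.

Lemma size_ffconv (R : realType) (n : nat) (p q : {poly R}) :
  (size (ffconv n p q) <= n.+1)%N.
Proof. by apply/leq_sizeP => l hl; rewrite coef_ffconv leqNgt hl. Qed.

Lemma coefn_ffconv (R : realType) (n : nat) (p q : {poly R}) :
  (ffconv n p q)`_n = p`_n * q`_n.
Proof.
by rewrite coef_ffconv leqnn subnn big_ord1 subn0 addn0 divff ?mul1r.
Qed.

(** Convolution with [q] acts as a polynomial in the differentiation operator with constant
    coefficients, hence commutes with differentiation. *)
Lemma ffconv_derivE (R : realType) (n : nat) (p q : {poly R}) :
  (size p <= n.+1)%N ->
  ffconv n p q = \sum_(k < n.+1) ((n - k)`!%:R / n`!%:R * q`_(n - k)) *: p^`(k).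
Proof.
move=> hp; apply/polyP => l; rewrite ffconvC coef_ffconv coef_sum.
have f0 m : m`!%:R != 0 :> R by rewrite pnatr_eq0 eqn0Ngt fact_gt0.
case: leqP => hl; last first.
  rewrite big1 // => k _; rewrite coefZ coef_derivn [p`__]nth_default ?mul0rn ?mulr0 //.
  by rewrite (leq_trans hp) // (leq_trans hl) // leq_addl.
have hnl : ((n - l).+1 <= n.+1)%N by rewrite ltnS leq_subr.
rewrite (big_ord_widen _ (fun i => ((n - i)`! * (l + i)`!)%N%:R / (n`! * l`!)%N%:R
      * q`_(n - i) * p`_(l + i)) hnl) big_mkcond /=.
apply: eq_bigr => k _; rewrite coefZ coef_derivn ltnS; case: leqP => hk; last first.
  rewrite [p`__]nth_default ?mul0rn ?mulr0 // (leq_trans hp) //.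
  by lia.
have -> : (k + l = l + k)%N by rewrite addnC.
rewrite -(ffact_fact (leq_addl l k)) addnK -mulr_natr !natrM.
by field; rewrite !f0.
Qed.

(** The last term vanishes because [g] has degree at most [n]; the other weights are those of the
    normalised derivative of [q] in degree [n]. *)
Lemma ffconv_lower (R : realType) (n : nat) (g q : {poly R}) :
  (size g <= n.+1)%N ->
  ffconv n.+1 g q = ffconv n g (n.+1%:R^-1 *: q^`()).
Proof.
move=> hg; rewrite !ffconv_derivE ?(leq_trans hg) //.
rewrite big_ord_recr derivn_poly0 // scaler0 /= addr0.
apply: eq_bigr => k _; congr (_ *: _).
have hk : (k <= n)%N by rewrite -ltnS.
rewrite subSn // coefZ coef_deriv !factS !natrM -mulr_natr.
by field; rewrite nat1r !pnatr_eq0 !eqn0Ngt fact_gt0.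
Qed.

Lemma derivn_mulX (R : realType) (g : {poly R}) (k : nat) :
  ('X * g)^`(k) = 'X * g^`(k) + g^`(k.-1) *+ k.
Proof.
elim: k => [|k IHk]; first by rewrite !derivn0 mulr0n addr0.
rewrite derivnS IHk derivD derivM derivX mul1r derivMn -!derivnS /=.
rewrite addrC addrA; case: k {IHk} => [|k] /=; first by rewrite mulr0n add0r addrC.
by rewrite -mulrSr addrC.
Qed.

(* [(n + 1) q - 'X q'] is the polar derivative of [q] at the origin. *)
Lemma ffconv_mulX (R : realType) (n : nat) (g q : {poly R}) :
  (size g <= n.+1)%N ->
  ffconv n.+1 ('X * g) q = 'X * ffconv n g (n.+1%:R^-1 *: q^`())
    + ffconv n g (q - 'X * (n.+1%:R^-1 *: q^`())).
Proof.
move=> hg; rewrite -ffconv_lower // ffconv_derivE; last first.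
  by rewrite mulrC (leq_trans (size_polyMleq _ _)) // size_polyX addn2.
rewrite (@ffconv_derivE _ n.+1) ?(leq_trans hg) // ffconv_derivE //.
under eq_bigr do rewrite derivn_mulX scalerDr.
rewrite big_split /= mulr_sumr; congr (_ + _).
  by apply: eq_bigr => k _; rewrite scalerAr.
rewrite big_ord_recl /= mulr0n scaler0 add0r; apply: eq_bigr => k _.
rewrite /bump /= add1n add0n /= subSS -scalerMnr scalerMnl; congr (_ *: _).
have hk : (k <= n)%N by rewrite -ltnS.
rewrite coefB coefXM coefZ coef_deriv factS natrM.
have h0 : n.+1%:R != 0 :> R by rewrite pnatr_eq0.
have hf : n`!%:R != 0 :> R by rewrite pnatr_eq0 eqn0Ngt fact_gt0.
(* With [j = n - k], the Leibniz factor [k.+1] yields the coefficient [q_j - j q_j / (n + 1)] of the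
   normalised polar derivative. *)
have hs : k.+1%:R = n.+1%:R - (n - k)%N%:R :> R.
  by rewrite -natrB ?leqW ?leq_subr // subSn ?leq_subr // subKn.
rewrite -[_ *+ k.+1]mulr_natr hs; case: (n - k)%N => [|j] /=.
  by field; rewrite hf nat1r h0.
by rewrite -[q`__ *+ _]mulr_natr; field; rewrite hf nat1r h0.
Qed.

Lemma deriv_ffconv (R : realType) (n : nat) (p q : {poly R}) :
  (size p <= n.+1)%N -> (ffconv n p q)^`() = ffconv n p^`() q.
Proof.
move=> hp; rewrite !ffconv_derivE //; last first.
  by rewrite (leq_trans (size_poly _ _)) // (leq_trans (leq_pred _)).
rewrite raddf_sum; apply: eq_bigr => k _ /=.
by rewrite derivZ -derivnS derivSn.
Qed.

Local Notation prodX s := (\prod_(b <- s) ('X - b%:P)).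

(** * Interlacing and partial fractions *)

(** Numerator of the derivative of [p / q]: its positivity expresses interlacing. *)
Definition wronsk (R : comNzRingType) (p q : {poly R}) : {poly R} :=
  p^`() * q - p * q^`().

Lemma prodX_rem (R : comNzRingType) (s : seq R) (x : R) :
  x \in s -> prodX s = ('X - x%:P) * prodX (rem x s).
Proof. by move=> xs; rewrite (perm_big _ (perm_to_rem xs)) big_cons. Qed.

Lemma deriv_prodX (R : comNzRingType) (s : seq R) :
  (prodX s)^`() = \sum_(x <- s) prodX (rem x s).
Proof.
elim: s => [|a s IHs]; first by rewrite !big_nil derivC.
rewrite !big_cons derivM derivXsubC mul1r IHs /= eqxx; congr (_ + _).
rewrite mulr_sumr; apply: eq_big_seq => x xs.
case: eqVneq => [->|_]; last by rewrite big_cons.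
by rewrite -prodX_rem.
Qed.

Lemma horner_deriv_prodX (R : idomainType) (s : seq R) (x : R) :
  x \in s -> (prodX s)^`().[x] = (prodX (rem x s)).[x].
Proof.
by move=> xs; rewrite (prodX_rem xs) derivM derivXsubC mul1r !hornerE subrr mul0r addr0.
Qed.

Lemma horner_prodX_rem_neq0 (R : idomainType) (s : seq R) (x : R) :
  uniq s -> x \in s -> (prodX (rem x s)).[x] != 0.
Proof. by move=> us xs; rewrite -/(root _ _) root_prod_XsubC mem_rem_uniq // inE eqxx. Qed.

Lemma uniq_deriv_neq0 (R : idomainType) (s : seq R) :
  (forall x, x \in s -> (prodX s)^`().[x] != 0) -> uniq s.
Proof.
elim: s => [//|a s IHs] h /=; apply/andP; split.
  have /h : a \in a :: s by rewrite inE eqxx.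
  rewrite horner_deriv_prodX ?inE ?eqxx //= eqxx.
  by rewrite -/(root _ _) root_prod_XsubC.
apply: IHs => x xs; have /h : x \in a :: s by rewrite inE xs orbT.
rewrite big_cons derivM derivXsubC mul1r hornerD.
have /rootP -> : root (prodX s) x by rewrite root_prod_XsubC.
by rewrite add0r hornerM mulf_eq0 negb_or => /andP[].
Qed.

(** Both sides agree at the points of [t], and their difference has degree below the number of these
    points. *)
Lemma lagrange (F : fieldType) (t : seq F) (p : {poly F}) :
  uniq t -> (size p <= size t)%N ->
  p = \sum_(x <- t) (p.[x] / (prodX t)^`().[x]) *: prodX (rem x t).
Proof.
move=> ut sp; apply/eqP; rewrite -subr_eq0; apply/eqP.
apply: (@roots_geq_poly_eq0 _ _ t) => //; last first.
  rewrite (leq_trans (size_polyD _ _)) // geq_max sp size_polyN.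
  rewrite (leq_trans (size_sum _ _ _)) //; apply/bigmax_leqP_seq => x xt _.
  rewrite (leq_trans (size_scale_leq _ _)) //.
  by rewrite size_prod_XsubC size_rem // prednK //; case: (t) xt.
apply/allP => y yt; rewrite /root hornerD hornerN horner_sum (bigD1_seq y) //=.
rewrite [X in _ - (_ + X)]big1_seq ?addr0 => [|x /andP[xy xt]].
  rewrite hornerZ horner_deriv_prodX // divfK ?subrr //.
  exact: horner_prodX_rem_neq0.
rewrite hornerZ; have /rootP -> : root (prodX (rem x t)) y.
  by rewrite root_prod_XsubC mem_rem_uniq // !inE eq_sym xy.
by rewrite mulr0.
Qed.

Lemma partial_fraction (F : fieldType) (t : seq F) (p : {poly F}) :
  uniq t -> p \is monic -> size p = (size t).+2 ->
  exists mu : F, p = ('X - mu%:P) * prodX t +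
    \sum_(x <- t) (p.[x] / (prodX t)^`().[x]) *: prodX (rem x t).
Proof.
move=> ut /monicP lp sp; set P := prodX t.
have sP : size P = (size t).+1 by rewrite size_prod_XsubC.
have lP : P`_(size t) = 1.
  by have /monicP := monic_prod_XsubC t xpredT id; rewrite /lead_coef sP.
(* [mu] cancels the coefficient of degree [size t] left in [p - 'X * P], so that [r] is the
   remainder of [p] modulo [P]. *)
pose mu := - (p - 'X * P)`_(size t).
pose r := p - ('X - mu%:P) * P.
have er : r = (p - 'X * P) + mu *: P by rewrite /r -mul_polyC; ring.
have sr : (size r <= size t)%N.
  apply/leq_sizeP => j; rewrite leq_eqVlt => /predU1P[<-|].
    by rewrite er coefD coefZ lP mulr1 /mu subrr.
  rewrite leq_eqVlt er coefD coefB coefZ coefXM => /predU1P[<-|] /=.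
    by rewrite lP -{1}lp /lead_coef sp subrr [P`__]nth_default ?sP // mulr0 addr0.
  case: j => // j hj /=; rewrite !nth_default ?sP ?sp ?mulr0 ?subrr ?addr0 //.
  by rewrite (leq_trans _ hj).
exists mu; rewrite -/P; set q := \sum_(x <- t) _.
suff -> : q = r by rewrite /r addrC subrK.
rewrite (lagrange ut sr) -/P; apply: eq_big_seq => x xt.
rewrite /r hornerD hornerN hornerM.
by have /rootP -> : root P x; rewrite ?root_prod_XsubC // mulr0 subr0.
Qed.

(** Recursion on the roots for Laguerre's inequality [q' ^ 2 - q q'' >= 0], whose left side is this
    Wronskian. *)
Lemma laguerre_cons (R : comNzRingType) (a : R) (p : {poly R}) :
  let q := ('X - a%:P) * p in
  wronsk q q^`() = p ^+ 2 + ('X - a%:P) ^+ 2 * wronsk p p^`().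
Proof.
rewrite /wronsk derivM derivXsubC derivD !derivM derivXsubC derivC.
ring.
Qed.

Lemma laguerre_ge0 (R : realDomainType) (s : seq R) (x : R) :
  0 <= (wronsk (prodX s) (prodX s)^`()).[x].
Proof.
elim: s => [|a s IHs].
  by rewrite big_nil /wronsk derivC mul0r sub0r deriv0 mulr0 oppr0 horner0.
rewrite big_cons laguerre_cons hornerD horner_exp hornerM horner_exp hornerXsubC.
by rewrite addr_ge0 ?sqr_ge0 // mulr_ge0 ?sqr_ge0.
Qed.

Lemma laguerre_gt0 (R : realDomainType) (s : seq R) (x : R) :
  uniq s -> s != [::] -> 0 < (wronsk (prodX s) (prodX s)^`()).[x].
Proof.
elim: s => [//|a s IHs] /= /andP[as_ us] _.
rewrite big_cons laguerre_cons hornerD horner_exp hornerM horner_exp hornerXsubC.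
have h1 := sqr_ge0 (x - a); have h2 := laguerre_ge0 s x.
have [sx0|sx0] := eqVneq (prodX s).[x] 0.
  have xs : x \in s by rewrite -root_prod_XsubC; apply/rootP.
  have sn : s != [::] by case: (s) xs.
  have xa : x - a != 0 by rewrite subr_eq0; apply: contraNneq as_ => <-.
  rewrite sx0 expr0n /= add0r mulr_gt0 //; last exact: IHs.
  by rewrite lt_def sqrf_eq0 xa.
apply: ltr_pwDl; last exact: mulr_ge0.
by rewrite lt_def sqrf_eq0 sx0 sqr_ge0.
Qed.

Lemma Im_sub_inv_lt0 (R : rcfType) (z : R[i]) (x : R) :
  complex.Im z != 0 -> complex.Im (z - x%:C)%C^-1 * complex.Im z < 0.
Proof.
case: z => a b /= b0; rewrite oppr0 addr0.
set d := _ + b ^+ 2; have d0 : 0 < d.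
  by rewrite ltr_wpDl ?sqr_ge0 // lt_def sqrf_eq0 b0 sqr_ge0.
rewrite mulNr mulrAC oppr_lt0 divr_gt0 // -expr2.
by rewrite lt_def sqrf_eq0 b0 sqr_ge0.
Qed.

(* Dividing by [prodX t], a complex root [z] satisfies
   [c0 z - mu = \sum_(x <- c) w x / (z - x)], whose two sides have imaginary
   parts of opposite signs unless [z] is real. *)
Lemma partial_fraction_split (R : rcfType) (t c : seq R) (w : R -> R)
    (c0 mu : R) :
  {subset c <= t} -> {in c, forall x, 0 < w x} -> 0 <= c0 ->
  (0 < c0) || (c != [::]) ->
  let p := (c0 *: 'X - mu%:P) * prodX t - \sum_(x <- c) w x *: prodX (rem x t) in
  exists v, p = lead_coef p *: prodX v.
Proof.
move=> ct w0 c00 hc p.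
have [f fE] : exists f : {rmorphism R -> R[i]}, forall x, f x = (x%:C)%C.
  by exists [the {rmorphism R -> R[i]} of real_complex R].
have [r er] := closed_field_poly_normal (map_poly f p).
have [p0|p0] := eqVneq p 0; first by exists [::]; rewrite p0 lead_coef0 scale0r.
have fp0 : map_poly f p != 0 by rewrite map_poly_eq0.
suff rr : {in r, forall z, z = f (complex.Re z)}.
  exists (map (@complex.Re R) r); apply: (map_inj_poly (fmorph_inj f) (rmorph0 f)).
  rewrite linearZ /= -lead_coef_map er; congr (_ *: _).
    by rewrite -er.
  rewrite rmorph_prod big_map; apply: eq_big_seq => z zr.
  by rewrite rmorphB /= map_polyX map_polyC /= -rr.
move=> z zr; have {}zr : root (map_poly f p) z.
  by rewrite er rootZ ?root_prod_XsubC // lead_coef_eq0.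
suff hz : complex.Im z = 0 by rewrite fE; case: (z) hz => a b /= ->.
apply/eqP; move: zr; apply: contraTT => z0.
have zx x : z - f x != 0.
  by rewrite subr_eq0; apply: contra_neq z0 => ->; rewrite fE.
pose P := (map_poly f (prodX t)).[z].
have P0 : P != 0.
  rewrite /P rmorph_prod horner_prod prodf_seq_neq0; apply/allP => x _.
  by rewrite rmorphB /= map_polyX map_polyC !hornerE /= zx.
have Prem x : x \in t -> (map_poly f (prodX (rem x t))).[z] = P / (z - f x).
  move=> xt; rewrite /P (prodX_rem xt) rmorphM rmorphB /= map_polyX map_polyC.
  by rewrite hornerM hornerXsubC mulrAC divff ?mul1r // zx.
pose S := \sum_(x <- c) f (w x) * (z - f x)^-1.
rewrite /root; have -> : (map_poly f p).[z] = P * (f c0 * z - f mu - S).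
  rewrite /p rmorphB rmorphM rmorphB /= map_polyZ map_polyX map_polyC.
  rewrite hornerD hornerN hornerM hornerD hornerN hornerZ hornerX hornerC /=.
  rewrite -/P mulrBr mulrC; congr (_ - _).
  rewrite rmorph_sum horner_sum mulr_sumr; apply: eq_big_seq => x xc.
  by rewrite /= map_polyZ hornerZ Prem ?ct //; ring.
rewrite mulf_eq0 negb_or P0 /=.
have ImD (u v : R[i]) : complex.Im (u + v) = complex.Im u + complex.Im v.
  by case: u v => [? ?] [? ?].
have ImN (u : R[i]) : complex.Im (- u) = - complex.Im u by case: u.
have ImZ (a : R) (u : R[i]) : complex.Im (f a * u) = a * complex.Im u.
  by rewrite fE; case: u => x y /=; rewrite mul0r addr0.
have ImS : complex.Im S = \sum_(x <- c) w x * complex.Im (z - f x)^-1.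
  rewrite /S; elim: (c) => [|x s IHs]; first by rewrite !big_nil.
  by rewrite !big_cons ImD ImZ IHs.
suff : 0 < complex.Im (f c0 * z - f mu - S) * complex.Im z.
  by apply: contraTneq => -> /=; rewrite mul0r ltxx.
rewrite !ImD !ImN ImZ ImS fE /= subr0 mulrBl -mulrA.
have zz : 0 < complex.Im z * complex.Im z by rewrite -expr2 lt_def sqrf_eq0 z0 sqr_ge0.
have tneg x : x \in c -> 0 < - (w x * complex.Im (z - f x)^-1 * complex.Im z).
  by move=> xc; rewrite -mulrA -mulrN mulr_gt0 ?w0 // oppr_gt0 fE Im_sub_inv_lt0.
(* Strictness comes from the term in [c0] if it is positive, and otherwise from the head of the
   nonempty list [c]. *)
rewrite mulr_suml -sumrN; have [c0p|] := boolP (0 < c0).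
  apply: ltr_pwDl; first exact: mulr_gt0.
  by rewrite big_seq sumr_ge0 // => x xc; rewrite ltW ?tneg.
move=> c0n; move: hc; rewrite (negPf c0n) /= => cn.
apply: ltr_wpDl; first by rewrite mulr_ge0 // ltW.
case: (c) cn tneg => // x s _ tneg; rewrite big_cons.
apply: ltr_pwDl; first by rewrite tneg // inE eqxx.
by rewrite big_seq sumr_ge0 // => y ys; rewrite ltW ?tneg // inE ys orbT.
Qed.

(** Opposite signs at the points of [t] make the derivative of [prodX t] nonzero there, so [t] has
    no repetition, and make the Lagrange coefficients of [p] negative. *)
Lemma interlacing_partial_fraction (R : realFieldType) (p : {poly R}) (t : seq R) :
  p \is monic -> size p = (size t).+2 ->
  {in t, forall x, 0 < - p.[x] * (prodX t)^`().[x]} ->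
  uniq t /\ exists (w : R -> R) (mu : R), {in t, forall x, 0 < w x} /\
    p = ('X - mu%:P) * prodX t - \sum_(x <- t) w x *: prodX (rem x t).
Proof.
move=> mp sp ht.
have d0 x : x \in t -> (prodX t)^`().[x] != 0.
  by move=> /ht; apply: contraTneq => ->; rewrite mulr0 ltxx.
have ut : uniq t by apply: uniq_deriv_neq0.
split=> //; have [mu ep] := partial_fraction ut mp sp.
exists (fun x => - p.[x] / (prodX t)^`().[x]), mu; split.
  move=> x xt; have h := ht _ xt.
  have -> : - p.[x] / (prodX t)^`().[x]
    = (- p.[x] * (prodX t)^`().[x]) / (prodX t)^`().[x] ^+ 2.
    by field; exact: d0.
  by rewrite divr_gt0 // lt_def sqrf_eq0 d0 // sqr_ge0.
rewrite {1}ep -sumrN; congr (_ + _); apply: eq_bigr => x _.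
by rewrite -scaleNr mulNr opprK.
Qed.

(** At a root of [prodX t] the Wronskian is [- p] times the derivative of [prodX t], so partial
    fractions apply; at a root of [p] it is [p' * prodX t], so that root is simple. *)
Lemma wronsk_split (R : rcfType) (p : {poly R}) (t : seq R) :
  p \is monic -> size p = (size t).+2 ->
  (forall x, 0 < (wronsk p (prodX t)).[x]) ->
  exists2 v, uniq v & p = prodX v.
Proof.
move=> mp sp hW.
have ht : {in t, forall x, 0 < - p.[x] * (prodX t)^`().[x]}.
  move=> x xt; have := hW x; rewrite /wronsk hornerD hornerN !hornerM.
  have /rootP -> : root (prodX t) x by rewrite root_prod_XsubC.
  by rewrite mulr0 sub0r mulNr.
have [ut [w [mu [w0 ep]]]] := interlacing_partial_fraction mp sp ht.
have [] := @partial_fraction_split _ t t w 1 mu _ w0 ler01.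
- by [].
- by rewrite ltr01.
rewrite scale1r -ep => v; rewrite (monicP mp) scale1r => ev; exists v => //.
apply: uniq_deriv_neq0 => x xv; rewrite -ev.
have := hW x; apply: contraTneq => d0.
rewrite /wronsk hornerD hornerN !hornerM d0 mul0r.
have /rootP -> : root p x by rewrite ev root_prod_XsubC.
by rewrite mul0r subr0 ltxx.
Qed.

Lemma constant_undup (T : eqType) (s : seq T) :
  (size (undup s) <= 1)%N -> constant s.
Proof.
case: s => //= x s; rewrite -(mem_undup s) => h.
apply/allP => y ys /=; move: h; rewrite mem_undup.
case: ifP => xs; last first.
  by rewrite /= ltnS leqn0 size_eq0 => /eqP/undup_nil es; rewrite es in ys.
rewrite -(mem_undup s) in ys; rewrite -(mem_undup s) in xs.
by case: (undup s) xs ys => // a [|//] /=; rewrite !inE => /eqP -> /eqP ->.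
Qed.


Lemma wronsk_mulXsubC (R : comNzRingType) (p : {poly R}) (b : R) :
  wronsk (('X - b%:P) * p) p = p ^+ 2.
Proof. by rewrite /wronsk derivM derivXsubC; ring. Qed.

Lemma wronsk_sumr (R : comNzRingType) (I : Type) (r : seq I) (p : {poly R})
    (q : I -> {poly R}) :
  wronsk p (\sum_(i <- r) q i) = \sum_(i <- r) wronsk p (q i).
Proof.
rewrite /wronsk raddf_sum /= !mulr_sumr -sumrB.
by apply: eq_bigr.
Qed.

(** Split [s] into its distinct elements [u] and the rest [r]. The derivative is [prodX r * e],
    where [e / prodX u] is a sum of simple fractions; so [e] splits with roots [c], and
    [t = r ++ c]. The factor [prodX r] cancels between [prodX s] and its derivative, so only [c]
    carries weights. *)
Lemma deriv_prodX_split (R : rcfType) (m : nat) (s : seq R) :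
  size s = m.+1 ->
  exists t c (w : R -> R) (mu : R),
  [/\ size t = m /\ (prodX s)^`() = m.+1%:R *: prodX t,
      prodX s = ('X - mu%:P) * prodX t - \sum_(x <- c) w x *: prodX (rem x t),
      {subset c <= t} /\ {in c, forall x, 0 < w x},
      uniq s -> uniq t & c = [::] -> constant s].
Proof.
move=> ss; have [r sr] := perm_to_subseq (undup_subseq s).
set u := undup s in sr; have us : uniq u := undup_uniq s.
have eS : prodX s = prodX u * prodX r by rewrite (perm_big _ sr) big_cat.
pose e := \sum_(b <- s) prodX (rem b u).
have Xn0 (b : R) : 'X - b%:P != 0 by rewrite polyXsubC_eq0.
have eD : (prodX s)^`() = prodX r * e.
  rewrite deriv_prodX /e mulr_sumr; apply: eq_big_seq => b bs.
  have bu : b \in u by rewrite mem_undup.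
  apply: (mulfI (Xn0 b)); rewrite -prodX_rem // eS (prodX_rem bu); ring.
(* With [c0 = 0] the polynomial obtained is [- e]; repetitions in [s] account for multiplicities. *)
have [] := @partial_fraction_split _ u s (fun=> 1) 0 0 _ _ (lexx 0).
- by move=> x; rewrite mem_undup.
- by move=> x _; exact: ltr01.
- by rewrite ltxx /=; case: (s) ss.
rewrite scale0r subr0 mul0r sub0r (eq_bigr (fun x => prodX (rem x u))); last first.
  by move=> x _; rewrite scale1r.
rewrite -/e; set k := lead_coef _ => c /eqP; rewrite eqr_oppLR -scaleNr => /eqP ec.
set kappa := - k in ec.
pose t := r ++ c.
have eDt : (prodX s)^`() = kappa *: prodX t by rewrite eD ec -scalerAr big_cat.
have sS : size (prodX s) = m.+2 by rewrite size_prod_XsubC ss.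
have cm : (prodX s)^`()`_m = m.+1%:R.
  rewrite coef_deriv; have /monicP := monic_prod_XsubC s xpredT id.
  by rewrite /lead_coef sS /= => ->.
have k0 : kappa != 0.
  by apply/eqP => k0; move/eqP: cm; rewrite eDt k0 scale0r coef0 eq_sym pnatr_eq0.
have st : size t = m.
  apply: succn_inj; rewrite -(size_prod_XsubC t id) -(size_scale _ k0) -eDt.
  apply/eqP; rewrite eqn_leq; apply/andP; split.
    by rewrite (leq_trans (size_poly _ _)) // sS.
  by rewrite ltnNge; apply/negP => /leq_sizeP/(_ m (leqnn _))/eqP; rewrite cm pnatr_eq0.
have km : kappa = m.+1%:R.
  rewrite -cm eDt coefZ; have /monicP := monic_prod_XsubC t xpredT id.
  by rewrite /lead_coef size_prod_XsubC st /= => ->; rewrite mulr1.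
have sc : size (prodX u) = (size c).+2.
  have := perm_size sr; rewrite size_cat size_prod_XsubC ss => h.
  by move: st; rewrite size_cat => h'; apply/eqP;
    rewrite -(eqn_add2r (size r)) !addSn -h -h' addnC.
(* The Wronskian of [prodX u] and [e] is a sum of squares; at a root of [e] it is [kappa] times the
   product whose sign is wanted. *)
have hc : {in c, forall x, 0 < - (prodX u).[x] * (prodX c)^`().[x]}.
  move=> x xc.
  have /rootP cx : root (prodX c) x by rewrite root_prod_XsubC.
  have W : wronsk (prodX u) e = \sum_(b <- s) prodX (rem b u) ^+ 2.
    rewrite wronsk_sumr; apply: eq_big_seq => b bs.
    by rewrite [in LHS](@prodX_rem _ u b) ?mem_undup // wronsk_mulXsubC.
  have /(congr1 (horner^~ x)) := W.
  rewrite /wronsk hornerD hornerN !hornerM ec derivZ !hornerZ cx !mulr0 sub0r.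
  rewrite mulrCA -mulrN -mulNr => Wx.
  suff : 0 < kappa * (- (prodX u).[x] * (prodX c)^`().[x]).
    by rewrite pmulr_rgt0 // km ltr0n.
  (* Some square is nonzero at [x]: the one for [x] itself if [x] is in [u], any of them
     otherwise. *)
  have [b0 b0s b0x] : exists2 b, b \in s & (prodX (rem b u)).[x] != 0.
    have [xu|xu] := boolP (x \in u).
      by exists x; rewrite ?horner_prodX_rem_neq0 // -mem_undup.
    exists (head 0 s); first by case: (s) ss => // ? ? _; rewrite inE eqxx.
    by rewrite -/(root _ _) root_prod_XsubC; apply: contraNN xu; apply: mem_rem.
  rewrite Wx horner_sum (big_rem b0) //= ltr_pwDl //.
    by rewrite horner_exp lt_def sqrf_eq0 b0x sqr_ge0.
  by rewrite sumr_ge0 // => b _; rewrite horner_exp sqr_ge0.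
have mu_ : prodX u \is monic by apply: monic_prod_XsubC.
have [uc [w [mu [w0 eu]]]] := interlacing_partial_fraction mu_ sc hc.
exists t, c, w, mu; split.
- by rewrite eDt km.
- rewrite eS eu mulrBl -mulrA mulrC; congr (_ - _).
    by rewrite mulrC /t big_cat /= mulrCA mulrA [RHS]mulrC; ring.
  rewrite mulr_suml; apply: eq_big_seq => x xc; rewrite -scalerAl; congr (_ *: _).
  have xt : x \in t by rewrite mem_cat xc orbT.
  apply: (mulfI (Xn0 x)); rewrite -(prodX_rem xt) mulrA -prodX_rem //.
  by rewrite /t big_cat mulrC.
- by split=> // x xc; rewrite mem_cat xc orbT.
- move=> ss'; have r0 : r = [::].
    apply/nilP; rewrite /nilp -(eqn_add2l (size u)) addn0 -size_cat -(perm_size sr).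
    by rewrite /u undup_id.
  by rewrite /t r0.
- move=> c0; apply: constant_undup; rewrite -/u -ltnS -(size_prod_XsubC u id) sc.
  by rewrite c0.
Qed.

(** * Positivity of the Wronskian and real-rootedness *)

Lemma wronskDl (R : comNzRingType) (p q r : {poly R}) :
  wronsk (p + q) r = wronsk p r + wronsk q r.
Proof. by rewrite /wronsk derivD; ring. Qed.

Lemma wronskZl (R : comNzRingType) (a : R) (p q : {poly R}) :
  wronsk (a *: p) q = a *: wronsk p q.
Proof. by rewrite /wronsk derivZ scalerBr -!scalerAl. Qed.

Lemma wronskC (R : comNzRingType) (p q : {poly R}) : wronsk p q = - wronsk q p.
Proof. by rewrite /wronsk; ring. Qed.

Lemma wronskZr (R : comNzRingType) (a : R) (p q : {poly R}) :
  wronsk p (a *: q) = a *: wronsk p q.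
Proof. by rewrite wronskC wronskZl -scalerN -wronskC. Qed.

Lemma wronskpp (R : comNzRingType) (p : {poly R}) : wronsk p p = 0.
Proof. by rewrite /wronsk; ring. Qed.

Lemma wronsk_ffconv_mulXsubC (R : realType) (n : nat) (b : R) (g q : {poly R}) :
  wronsk (ffconv n (('X - b%:P) * g) q) (ffconv n g q) =
  wronsk (ffconv n ('X * g) q) (ffconv n g q).
Proof.
rewrite mulrBl mul_polyC ffconvDl ffconvNl ffconvZl -scaleNr.
by rewrite wronskDl wronskZl wronskpp scaler0 addr0.
Qed.

Lemma ffconv0_prodX_nil (R : realType) :
  ffconv 0 (prodX [::]) (prodX [::]) = 1 :> {poly R}.
Proof.
rewrite !big_nil; apply/polyP => -[|l]; first by rewrite coefn_ffconv coef1 mulr1.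
by rewrite coef_ffconv coef1.
Qed.

Lemma deriv_prodX_nseq (R : comNzRingType) (n : nat) (b : R) :
  (prodX (nseq n.+1 b))^`() = n.+1%:R *: prodX (nseq n b).
Proof.
rewrite deriv_prodX (eq_big_seq (fun=> prodX (nseq n b))).
  by rewrite big_const_seq count_predT size_nseq iter_addr_0 scaler_nat.
by move=> x /nseqP[-> _]; rewrite /= eqxx.
Qed.

(** The normalised derivative of [(X - b) ^ (m + 1)] is [(X - b) ^ m], and its normalised polar
    derivative is [- b] times the same power, so [ffconv_mulX] peels off one factor
    [X - (b + a)]. *)
Lemma ffconv_constant (R : realType) (t : seq R) (b : R) :
  ffconv (size t) (prodX t) (prodX (nseq (size t) b)) = prodX (map (+%R b) t).
Proof.
elim: t => [|a t IHt]; first by rewrite ffconv0_prodX_nil big_nil.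
have st : (size (prodX t) <= (size t).+1)%N by rewrite size_prod_XsubC.
rewrite [in LHS]big_cons map_cons big_cons -IHt /=.
rewrite mulrBl mul_polyC ffconvDl ffconvNl ffconvZl ffconv_mulX // ffconv_lower //.
rewrite -[b :: _]/(nseq (size t).+1 b) deriv_prodX_nseq scalerA mulVf ?pnatr_eq0 //.
rewrite scale1r [prodX (nseq _.+1 _)]/= big_cons; set Q := prodX (nseq _ _).
have -> : ('X - b%:P) * Q - 'X * Q = - b *: Q.
  by rewrite mulrBl mul_polyC scaleNr; ring.
by rewrite ffconvZr rmorphD /= -!mul_polyC rmorphN; ring.
Qed.

Lemma wronsk_ffconv_step (R : realType) (m : nat) (q : {poly R}) (g : {poly R})
    (t c : seq R) (w : R -> R) (mu : R) :
  (size g <= m.+1)%N ->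
  q^`() = m.+1%:R *: prodX t ->
  q = ('X - mu%:P) * prodX t - \sum_(x <- c) w x *: prodX (rem x t) ->
  {subset c <= t} ->
  wronsk (ffconv m.+1 ('X * g) q) (ffconv m.+1 g q) =
  ffconv m g (prodX t) ^+ 2 +
  \sum_(x <- c) w x *:
    wronsk (ffconv m ('X * prodX (rem x t)) g) (ffconv m (prodX (rem x t)) g).
Proof.
move=> sg dq eq ct; rewrite ffconv_mulX // ffconv_lower //.
rewrite dq scalerA mulVf ?pnatr_eq0 // scale1r.
set U := ffconv m g (prodX t).
have -> : q - 'X * prodX t =
    - mu *: prodX t - \sum_(x <- c) w x *: prodX (rem x t).
  by rewrite {1}eq mulrBl mul_polyC scaleNr; ring.
rewrite ffconvDr ffconvNr ffconvZr ffconv_sumr -/U addrA wronskDl.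
have -> : 'X * U + - mu *: U = ('X - mu%:P) * U by rewrite mulrBl mul_polyC scaleNr.
rewrite wronsk_mulXsubC; congr (_ + _).
rewrite -scaleN1r wronskZl scaleN1r -wronskC wronsk_sumr.
apply: eq_big_seq => x xc; rewrite ffconvZr wronskZr; congr (_ *: _).
(* Reading [U] as the convolution of [(X - x) * prodX (rem x t)] with [g] exchanges the two
   arguments for the induction. *)
rewrite /U (prodX_rem (ct _ xc)) ffconvC (ffconvC _ g).
by rewrite wronsk_ffconv_mulXsubC.
Qed.

(* The two alternatives swap along the induction, because the recursive call
   exchanges the roles of [s] and [t]. *)
Lemma wronsk_ffconv_gt0 (R : realType) (m : nat) (s t : seq R) (x : R) :
  size t = m -> size s = m.+1 ->
  (uniq t && ~~ constant s) || uniq s ->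
  0 < (wronsk (ffconv m.+1 ('X * prodX t) (prodX s))
              (ffconv m.+1 (prodX t) (prodX s))).[x].
Proof.
elim: m s t => [|m IHm] s t st ss hst.
  have [t' [c [w [mu [[st' dt'] et' [ct' w0] _ _]]]]] := deriv_prodX_split ss.
  rewrite (wronsk_ffconv_step _ dt' et' ct'); last by rewrite size_prod_XsubC st.
  rewrite (size0nil st) (size0nil st') in ct' *.
  have -> : c = [::] by case: (c) ct' => // y c' /(_ y); rewrite inE eqxx => /(_ isT).
  by rewrite [X in _ + X]big_nil addr0 ffconv0_prodX_nil expr1n hornerC ltr01.
have sg : (size (prodX t) <= m.+2)%N by rewrite size_prod_XsubC st.
(* A constant [t] may satisfy neither alternative of the recursive call. Here the convolution is a
   translate of [prodX s], and Laguerre's inequality concludes. *)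
have [/andP[us /(constantP 0)[b et]]|hst'] := boolP (uniq s && constant t).
  rewrite st in et; rewrite -(wronsk_ffconv_mulXsubC _ b).
  have -> : ('X - b%:P) * prodX t = prodX (nseq m.+2 b).
    by rewrite -[nseq m.+2 b]/(b :: nseq m.+1 b) big_cons -et.
  have eS : ffconv m.+2 (prodX (nseq m.+2 b)) (prodX s) = prodX (map (+%R b) s).
    by rewrite ffconvC -ss ffconv_constant.
  have eU : ffconv m.+2 (prodX t) (prodX s) = m.+2%:R^-1 *: (prodX (map (+%R b) s))^`().
    rewrite -eS deriv_ffconv ?size_prod_XsubC ?size_nseq // deriv_prodX_nseq.
    by rewrite ffconvZl scalerA mulVf ?pnatr_eq0 // scale1r -et.
  rewrite eS eU wronskZr hornerZ mulr_gt0 ?invr_gt0 ?ltr0n //.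
  apply: laguerre_gt0; last by case: (s) ss.
  by rewrite map_inj_uniq //; apply: addrI.
have ncs : ~~ constant s.
  case/orP: hst => [/andP[] //|us]; apply/negP => /(constantP 0)[b es].
  by move: us; rewrite es ss /= inE eqxx.
have [t' [c [w [mu [[st' dt'] et' [ct' w0] ut' nc]]]]] := deriv_prodX_split ss.
rewrite (wronsk_ffconv_step sg dt' et' ct') hornerD horner_exp.
have pos y : y \in c -> 0 < (w y *:
    wronsk (ffconv m.+1 ('X * prodX (rem y t')) (prodX t))
      (ffconv m.+1 (prodX (rem y t')) (prodX t))).[x].
  move=> yc; rewrite hornerZ mulr_gt0 ?w0 // IHm //.
    by rewrite size_rem ?ct' // st'.
  have [//|nut] := boolP (uniq t); first by rewrite orbT.
  case/orP: hst => [/andP[ut]|us]; first by rewrite ut in nut.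
  by rewrite orbF rem_uniq ?ut' //=; move: hst'; rewrite us.
(* The square may vanish; strictness comes from the sum, which is nonempty because [s] is not
   constant. *)
apply: ltr_wpDl; first exact: sqr_ge0.
rewrite horner_sum; case: (c) nc pos => [nc|y c' _ pos].
  by rewrite nc in ncs.
rewrite big_cons; apply: ltr_pwDl; first by rewrite pos // inE eqxx.
by rewrite big_seq sumr_ge0 // => z zc; rewrite ltW ?pos // inE zc orbT.
Qed.

Lemma monic_ffconv (R : realType) (n : nat) (p q : {poly R}) :
  p \is monic -> size p = n.+1 -> q \is monic -> size q = n.+1 ->
  ffconv n p q \is monic /\ size (ffconv n p q) = n.+1.
Proof.
move=> /monicP mp sp /monicP mq sq.
have cn : (ffconv n p q)`_n = 1.
  by move: mp mq; rewrite coefn_ffconv /lead_coef sp sq /= => -> ->; rewrite mulr1.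
have sn : size (ffconv n p q) = n.+1.
  apply/eqP; rewrite eqn_leq size_ffconv /= ltnNge; apply/negP.
  by move=> /leq_sizeP/(_ n (leqnn _))/eqP; rewrite cn oner_eq0.
by split=> //; apply/monicP; rewrite /lead_coef sn.
Qed.

(** Induction on [t]: with one root removed the convolution is some [prodX v], and [wronsk_split]
    applies to the positive Wronskian against it. A constant [s] only translates [t]. *)
Theorem ffconv_split (R : realType) (s t : seq R) :
  uniq t -> size s = size t ->
  exists2 v, uniq v & ffconv (size t) (prodX t) (prodX s) = prodX v.
Proof.
elim: t s => [|a t IHt] s ut ss.
  by exists [::]; rewrite // (size0nil ss) ffconv0_prodX_nil big_nil.
have [/(constantP 0)[b es]|ncs] := boolP (constant s).
  exists (map (+%R b) (a :: t)); last by rewrite es ss ffconv_constant.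
  by rewrite map_inj_uniq //; apply: addrI.
have [t' [c [w [mu [[st' dt'] _ _ _ _]]]]] := deriv_prodX_split ss.
have [v uv ev] := IHt t' (subseq_uniq (subseq_cons t a) ut) st'.
have [] := @monic_ffconv _ (size t).+1 (prodX (a :: t)) (prodX s);
  rewrite ?monic_prod_XsubC ?size_prod_XsubC ?ss // => mF sF.
have eU : ffconv (size t).+1 (prodX t) (prodX s) = prodX v.
  rewrite ffconv_lower ?size_prod_XsubC // dt' scalerA mulVf ?pnatr_eq0 //.
  by rewrite scale1r.
have sv : size v = size t.
  apply: succn_inj; rewrite -(size_prod_XsubC v id) -ev.
  by have [] := @monic_ffconv _ (size t) (prodX t) (prodX t');
    rewrite ?monic_prod_XsubC ?size_prod_XsubC ?st'.
apply: (wronsk_split (t := v) mF); first by rewrite sF sv.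
move=> x; rewrite -eU big_cons wronsk_ffconv_mulXsubC wronsk_ffconv_gt0 //.
by rewrite (subseq_uniq (subseq_cons t a) ut) ncs.
Qed.

(** * Differentiability *)

(** A product rule in which [K] need only be continuous: since [N] vanishes at [x], the variation of
    [K] enters at second order. *)
Lemma is_diff_littleo_mul (R : realFieldType) (V : normedModType R)
    (g N K : V -> R) (x : V) :
  differentiable N x -> N x = 0 -> {for x, continuous K} ->
  (\forall a \near x, g a = g x + N a * K a) ->
  differentiable g x /\ 'd g x = (fun v => K x * 'd N x v) :> (V -> R).
Proof.
move=> dN N0 cK gE.
have dNc : continuous ('d N x) by exact: diff_continuous.
have cKd : continuous (K x \*: 'd N x : V -> R).
  by move=> v; apply: cvgZr; exact: dNc.
have lo : g \o shift x = cst (g x) + (K x \*: 'd N x : V -> R) +o_ 0 id.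
  apply/eqaddoP => e e0.
  have [k k0 hk] := linear_lipschitz dNc.
  have /eqaddoP No := diff_locally dN.
  have Kx1 : 0 < `|K x| + 1 by rewrite ltr_wpDl.
  have e1 : 0 < e / 2 / (`|K x| + 1) by rewrite !divr_gt0.
  (* The bound [1] keeps [K] bounded near [x]; the bound [e / 2 / k] offsets the Lipschitz constant
     [k] of ['d N x]. *)
  have e2 : 0 < Num.min 1 (e / 2 / k) by rewrite lt_min ltr01 !divr_gt0.
  have gE0 : \forall h \near (0 : V), g (h + x) = g x + N (h + x) * K (h + x).
    by move: gE; rewrite (near_shift 0) /= subr0.
  have Kn : \forall h \near (0 : V), `|K x - K (h + x)| < Num.min 1 (e / 2 / k).
    have : \forall t \near x, `|K x - K t| < Num.min 1 (e / 2 / k).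
      by have /cvgrPdist_lt/(_ _ e2) := cK.
    by rewrite (near_shift 0) /= subr0.
  near=> h.
  have h1 : g (h + x) = g x + N (h + x) * K (h + x) by near: h.
  have h2 : `|K x - K (h + x)| < Num.min 1 (e / 2 / k) by near: h.
  have h3 : `|(N \o shift x - (cst (N x) + 'd N x : V -> R)) h|
     <= e / 2 / (`|K x| + 1) * `|h| by near: h; exact: No.
  move: h3; rewrite /= !fctE /= N0 add0r => h3.
  rewrite h1 opprD addrACA subrr add0r.
  set n := N _ in h3 *; set d := 'd N x h in h3 *.
  have hd : `|d| <= k * `|h| := hk h.
  have -> : n * K (h + x) - K x *: d
     = (n - d) * K (h + x) + (K (h + x) - K x) * d.
    by rewrite /GRing.scale /=; ring.
  rewrite (le_trans (ler_normD _ _)) // !normrM.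
  move: h2; rewrite lt_min distrC => /andP[h2 h2'].
  have hK : `|K (h + x)| <= `|K x| + 1.
    rewrite -[K (h + x)](subrK (K x)) addrC (le_trans (ler_normD _ _)) //.
    by rewrite lerD2l ltW.
  have -> : e * `|h| = e / 2 / (`|K x| + 1) * `|h| * (`|K x| + 1)
     + e / 2 / k * (k * `|h|).
    by field; rewrite ?gt_eqF.
  by apply: lerD; apply: ler_pM => //; exact: ltW.
have dg : 'd g x = (K x \*: 'd N x) :> (V -> R) by apply: diff_unique.
split; last exact: dg.
by apply/diff_locallyP; rewrite dg; split; [exact: cKd | exact: lo].
Unshelve. all: by end_near. Qed.

Lemma differentiable_row (R : realFieldType) (V : normedModType R) (n : nat)
    (G : V -> 'rV[R]_n) (x : V) :
  (forall i, differentiable (fun a => G a 0 i) x) -> differentiable G x.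
Proof.
move=> dG; have -> : G = \sum_(i < n) (fun a => G a 0 i *: delta_mx 0 i).
  by apply/funext => a; rewrite fct_sumE -row_sum_delta.
by apply: differentiable_sum => i; apply: differentiableZl.
Qed.

Lemma jacobian_row (R : realFieldType) (m n : nat) (G : 'rV[R]_m -> 'rV[R]_n)
    (x : 'rV[R]_m) (i : 'I_n) (j : 'I_m) :
  differentiable G x ->
  jacobian G x j i = 'D_(delta_mx 0 j) (fun a => G a 0 i) x.
Proof.
move=> dG; have := deriveEjacobian (delta_mx 0 j) dG.
rewrite derive_mx; last exact: diff_derivable.
by move=> /rowP/(_ i); rewrite -rowE !mxE => ->.
Qed.

Lemma derive_affine (R : realFieldType) (V : normedModType R) (f : V -> R)
    (x v : V) (c : R) :
  (forall h, f (h *: v + x) = f x + h * c) -> 'D_v f x = c.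
Proof.
move=> hf; apply: lim_near_cst => //; near=> h.
have h0 : h != 0 by near: h; exact: nbhs_dnbhs_neq.
by rewrite /= hf [_ + _ * _]addrC addrK /GRing.scale /= mulKf.
Unshelve. all: by end_near. Qed.

Lemma differentiable_prod (R : realFieldType) (V : normedModType R) (I : Type)
    (r : seq I) (f : I -> V -> R) (x : V) :
  (forall i, differentiable (f i) x) ->
  differentiable (fun a => \prod_(i <- r) f i a) x.
Proof.
move=> df; elim: r => [|i r IHr].
  by under eq_fun do rewrite big_nil; exact: differentiable_cst.
by under eq_fun do rewrite big_cons; exact: differentiableM.
Qed.

Lemma differentiable_bigsum (R : realFieldType) (V : normedModType R) (I : Type)
    (r : seq I) (f : I -> V -> R) (x : V) :
  (forall i, differentiable (f i) x) ->
  differentiable (fun a => \sum_(i <- r) f i a) x.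
Proof.
move=> df; elim: r => [|i r IHr].
  by under eq_fun do rewrite big_nil; exact: differentiable_cst.
by under eq_fun do rewrite big_cons; exact: differentiableD.
Qed.

(** Induction from the bottom gives [i <= f i]; induction on the distance [d] to the last index
    gives [f i <= i]. *)
Lemma ord_homo_id (n : nat) (f : 'I_n -> 'I_n) :
  {homo f : i j / (i < j)%N} -> f =1 id.
Proof.
move=> hf i; apply: val_inj; apply/eqP; rewrite eqn_leq; apply/andP; split.
  suff h d (k : 'I_n) : (k + d).+1 = n -> (f k + d < n)%N.
    have := h (n - i.+1)%N i; rewrite -addSn subnKC // => /(_ erefl) /=.
    by have := ltn_ord i; lia.
  elim: d k => [|d IHd] k; first by rewrite !addn0.
  move=> e; have k1 : (k.+1 < n)%N by lia.
  have := IHd (Ordinal k1); rewrite /= addSn -addnS => /(_ e).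
  by have := hf k (Ordinal k1) (leqnn _); lia.
suff h d (k : 'I_n) : nat_of_ord k = d -> (d <= f k)%N by exact: h.
elim: d k => [//|d IHd] k e; have d1 : (d < n)%N by have := ltn_ord k; lia.
by apply: leq_ltn_trans (IHd (Ordinal d1) erefl) _; apply: hf; rewrite /= e.
Qed.

Lemma pos_lower_bound (R : realFieldType) (I : finType) (f : I -> R) :
  (forall i, 0 < f i) -> exists2 d, 0 < d & forall i, d <= f i.
Proof.
move=> f0; exists (\big[Num.min/1]_i f i).
  by elim/big_ind: _ => // x y x0 y0; rewrite lt_min x0.
by move=> i; exact: bigmin_le.
Qed.

(** * The sorted roots as functions of the first argument *)

(** List form of a row vector, to which [rem], [uniq] and the lemmas on [prodX] apply. *)
Definition entries (T : Type) (n : nat) (a : 'rV[T]_n) : seq T :=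
  [seq a 0 i | i <- enum 'I_n].

Lemma size_entries (T : Type) (n : nat) (a : 'rV[T]_n) : size (entries a) = n.
Proof. by rewrite size_map size_enum_ord. Qed.

Lemma mem_entries (T : eqType) (n : nat) (a : 'rV[T]_n) (i : 'I_n) :
  a 0 i \in entries a.
Proof. by apply: map_f; rewrite mem_enum. Qed.

Lemma uniq_entries_inj (T : eqType) (n : nat) (a : 'rV[T]_n) :
  uniq (entries a) -> injective (a 0).
Proof.
move=> ua i j e; apply/ord_inj/eqP.
rewrite -(nth_uniq (a 0 i) _ _ ua) ?size_entries //.
have h k : nth (a 0 i) (entries a) (nat_of_ord k) = a 0 k.
  by rewrite (nth_map k) ?size_enum_ord // nth_ord_enum.
by rewrite !h e.
Qed.

Lemma uniq_entries_lt (d : Order.disp_t) (T : porderType d) (n : nat) (a : 'rV[T]_n) :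
  (forall i j : 'I_n, (i < j)%N -> (a 0 i < a 0 j)%O) -> uniq (entries a).
Proof.
move=> ha; rewrite map_inj_uniq ?enum_uniq // => i j e; apply: val_inj.
by case: (ltngtP i j) => // /ha; rewrite e ltxx.
Qed.

Lemma rootpolyE (R : realType) (n : nat) (a : 'rV[R]_n) :
  rootpoly a = prodX (entries a).
Proof. by rewrite /rootpoly big_map big_enum. Qed.

Lemma prodX_rem_entries (R : realType) (n : nat) (a : 'rV[R]_n) (i : 'I_n) :
  prodX (rem (a 0 i) (entries a)) = \prod_(k | k != i) ('X - (a 0 k)%:P).
Proof.
have X0 : 'X - (a 0 i)%:P != 0 by rewrite polyXsubC_eq0.
by apply: (mulfI X0); rewrite -prodX_rem ?mem_entries // -rootpolyE /rootpoly (bigD1 i).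
Qed.

(** Each single root enters with degree one, so the partial derivatives are exact difference
    quotients. *)
Lemma rootpoly_line (R : realType) (n : nat) (a : 'rV[R]_n) (j : 'I_n) (h : R) :
  rootpoly (h *: delta_mx 0 j + a) =
  rootpoly a - h *: prodX (rem (a 0 j) (entries a)).
Proof.
rewrite prodX_rem_entries /rootpoly (bigD1 j) // [in RHS](bigD1 j) //=.
rewrite (eq_bigr (fun k => 'X - (a 0 k)%:P)); last first.
  by move=> k /negPf kj; rewrite !mxE eqxx kj mulr0 add0r.
by rewrite !mxE !eqxx mulr1 rmorphD /= -mul_polyC; ring.
Qed.

Lemma prodX_perm (F : fieldType) (s t : seq F) :
  prodX s = prodX t -> perm_eq s t.
Proof. by move=> e; apply/allP => x _ /=; rewrite -!mu_prod_XsubC e. Qed.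

(** Sorting the roots given by [ffconv_split] yields a witness, so [xget] does not fall back on its
    default. *)
Lemma Omega_spec (R : realType) (n : nat) (a beta : 'rV[R]_n) :
  uniq (entries a) ->
  increasing_roots (ffconv n (rootpoly a) (rootpoly beta)) (Omega a beta) /\
  uniq (entries (Omega a beta)).
Proof.
move=> ua; have [] := @ffconv_split R (entries beta) _ ua.
  by rewrite !size_entries.
rewrite size_entries -!rootpolyE => v uv ev.
have sv : size v = n.
  apply: succn_inj; rewrite -(size_prod_XsubC v id) -ev.
  by have [] := @monic_ffconv R n (rootpoly a) (rootpoly beta);
    rewrite ?rootpolyE ?monic_prod_XsubC ?size_prod_XsubC ?size_entries.
have inc : exists g : 'rV[R]_n, increasing_roots (ffconv n (rootpoly a) (rootpoly beta)) g.
  exists (\row_(i < n) (sort <=%R v)`_i); split.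
    move=> i j ij; rewrite !mxE; have sz : sorted <=%R (sort <=%R v) by apply: sort_le_sorted.
    by apply: (sorted_leq_nth le_trans lexx) => //; rewrite inE size_sort sv.
  rewrite ev rootpolyE; have -> : entries (\row_(i < n) (sort <=%R v)`_i) = sort <=%R v.
    apply: (@eq_from_nth _ 0); rewrite size_entries ?size_sort ?sv // => i hi.
    by rewrite /entries (nth_map (Ordinal hi)) ?size_enum_ord // mxE nth_enum_ord.
  by rewrite (perm_big _ (permEl (perm_sort _ _))).
have hO : increasing_roots (ffconv n (rootpoly a) (rootpoly beta)) (Omega a beta).
  by case: inc => g hg; apply: (xgetPex 0 (ex_intro _ g hg)).
split=> //; rewrite (perm_uniq (prodX_perm (t := v) _)) //.
by rewrite -rootpolyE -ev; case: hO.
Qed.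

(** Interpolation at the [n.+1] nodes [0, ..., n] writes [rootpoly b] as a combination of fixed
    polynomials with coefficients polynomial in [b]; linearity of the convolution does the rest. *)
Lemma differentiable_ffconv_horner (R : realType) (n : nat) (q : {poly R}) (x : R)
    (a : 'rV[R]_n) :
  differentiable (fun b : 'rV[R]_n => (ffconv n (rootpoly b) q).[x]) a.
Proof.
pose t : seq R := [seq i%:R | i <- iota 0 n.+1].
have ut : uniq t by rewrite map_inj_uniq ?iota_uniq // => i j /eqP; rewrite eqr_nat => /eqP.
pose c y := (ffconv n (prodX (rem y t)) q).[x] / (prodX t)^`().[y].
have -> : (fun b : 'rV[R]_n => (ffconv n (rootpoly b) q).[x]) =
    (fun b => \sum_(y <- t) c y * \prod_(i <- enum 'I_n) (y - b 0 i)).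
  apply/funext => b; rewrite {1}(lagrange (p := rootpoly b) ut).
    rewrite ffconv_suml horner_sum; apply: eq_bigr => y _.
    rewrite ffconvZl hornerZ /c /rootpoly horner_prod -big_enum /=.
    under eq_bigr do rewrite hornerXsubC; rewrite mulrC mulrA mulrAC; ring.
  by rewrite rootpolyE size_prod_XsubC size_entries size_map size_iota.
apply: differentiable_bigsum => y.
apply: (@differentiableM _ _ (fun=> c y)); first exact: differentiable_cst.
apply: differentiable_prod => i; apply: (@differentiableB _ _ _ (fun=> y)).
  exact: differentiable_cst.
exact: differentiable_coord.
Qed.

Lemma derive_ffconv_horner (R : realType) (n : nat) (q : {poly R}) (x : R)
    (a : 'rV[R]_n) (j : 'I_n) :
  'D_(delta_mx 0 j) (fun b : 'rV[R]_n => (ffconv n (rootpoly b) q).[x]) a =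
  - (ffconv n (prodX (rem (a 0 j) (entries a))) q).[x].
Proof.
apply: derive_affine => h; rewrite rootpoly_line ffconvDl ffconvNl ffconvZl.
by rewrite hornerD hornerN hornerZ mulrN.
Qed.

Lemma cvg_bigprod (R : realFieldType) (T I : Type) (F : set_system T) {FF : Filter F}
    (r : seq I) (P : pred I) (f : I -> T -> R) (l : I -> R) :
  (forall i, f i a @[a --> F] --> l i) ->
  \prod_(i <- r | P i) f i a @[a --> F] --> \prod_(i <- r | P i) l i.
Proof.
move=> fl; elim: r => [|i r IHr].
  by under eq_fun do rewrite big_nil; rewrite big_nil; exact: cvg_cst.
under eq_fun do rewrite big_cons; rewrite big_cons; case: ifP => // _.
exact: cvgM.
Qed.

(** With [d] half a lower bound of the gaps, the open intervals of radius [d] around the entries are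
    disjoint and ordered. *)
Lemma strict_gap (R : realFieldType) (n : nat) (a : 'rV[R]_n) :
  (forall i j : 'I_n, (i < j)%N -> a 0 i < a 0 j) ->
  exists2 d, 0 < d & forall i j : 'I_n, (i < j)%N -> a 0 i + d <= a 0 j - d.
Proof.
move=> ha; pose f (ij : 'I_n * 'I_n) :=
  if (ij.1 < ij.2)%N then a 0 ij.2 - a 0 ij.1 else 1.
have [ij|d d0 hd] := @pos_lower_bound _ _ f.
  by rewrite /f; case: ifP => // /ha; rewrite subr_gt0.
exists (d / 2); first by rewrite divr_gt0.
by move=> i j ij; have := hd (i, j); rewrite /f /= ij; lra.
Qed.

Lemma near_entries (R : realFieldType) (n : nat) (a : 'rV[R]_n) (e : R) :
  0 < e -> \forall b \near a, forall i, `|a 0 i - (b : 'rV[R]_n) 0 i| < e.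
Proof.
move=> e0.
apply: (@filter_forall _ _ (fun i (b : 'rV[R]_n) => `|a 0 i - b 0 i| < e) (nbhs a)) => i.
have : (fun b : 'rV[R]_n => b 0 i) @ a --> a 0 i by exact: coord_continuous.
by move/cvgrPdist_lt; apply.
Qed.

Lemma strict_near (R : realFieldType) (n : nat) (a : 'rV[R]_n) :
  (forall i j : 'I_n, (i < j)%N -> a 0 i < a 0 j) ->
  \forall b \near a, forall i j : 'I_n, (i < j)%N -> (b : 'rV[R]_n) 0 i < b 0 j.
Proof.
move=> ha; have [d d0 hd] := strict_gap ha.
near=> b => i j ij.
have hb : forall i, `|a 0 i - b 0 i| < d by near: b; exact: near_entries.
have := hd _ _ ij; have := hb i; have := hb j.
by rewrite !ltr_norml => /andP[? ?] /andP[? ?] ?; lra.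
Unshelve. all: by end_near. Qed.

Lemma Omega_strict (R : realType) (n : nat) (a beta : 'rV[R]_n) :
  uniq (entries a) -> forall i j : 'I_n, (i < j)%N ->
  Omega a beta 0 i < Omega a beta 0 j.
Proof.
move=> ua i j ij; have [[inc _] ug] := Omega_spec beta ua.
rewrite lt_neqAle inc ?(ltnW ij) // andbT; apply/eqP => /(uniq_entries_inj ug) e.
by rewrite e ltnn in ij.
Qed.

Lemma horner_ffconv_Omega (R : realType) (n : nat) (a beta : 'rV[R]_n) (x : R) :
  uniq (entries a) -> (ffconv n (rootpoly a) (rootpoly beta)).[x] =
  \prod_(k < n) (x - Omega a beta 0 k).
Proof.
move=> ua; have [[_ ->] _] := Omega_spec beta ua.
by rewrite /rootpoly horner_prod; apply: eq_bigr => k _; rewrite hornerXsubC.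
Qed.

(* If the value at [gamma_i] of the convolution for [a] is less than [e ^ n], one of
   its roots is [e]-close to [gamma_i]; since these intervals are disjoint and
   ordered, the [k]-th root is the one near [gamma_k]. *)
Lemma Omega_near (R : realType) (n : nat) (alpha beta : 'rV[R]_n) (e : R) :
  (forall i j : 'I_n, (i < j)%N -> alpha 0 i < alpha 0 j) -> 0 < e ->
  \forall a \near alpha, forall k, `|Omega alpha beta 0 k - Omega a beta 0 k| < e.
Proof.
move=> ha e0; have ua := uniq_entries_lt ha.
have [d d0 hd] := strict_gap (Omega_strict beta ua).
pose e' := Num.min e d; have e'0 : 0 < e' by rewrite lt_min e0.
set g := Omega alpha beta in hd *.
have small : \forall a \near alpha, forall i,
    `|(ffconv n (rootpoly a) (rootpoly beta)).[g 0 i]| < e' ^+ n.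
  apply: (@filter_forall _ _ (fun i (a : 'rV[R]_n) =>
    `|(ffconv n (rootpoly a) (rootpoly beta)).[g 0 i]| < e' ^+ n) (nbhs alpha)) => i.
  have /differentiable_continuous/cvgrPdist_lt/(_ (e' ^+ n)) :=
    @differentiable_ffconv_horner R n (rootpoly beta) (g 0 i) alpha.
  rewrite exprn_gt0 // => /(_ isT).
  rewrite horner_ffconv_Omega // (bigD1 i) //= subrr mul0r.
  by apply: filterS => a; rewrite sub0r normrN.
near=> a.
have ha' : forall i j : 'I_n, (i < j)%N -> a 0 i < a 0 j.
  by near: a; exact: strict_near.
have ua' := uniq_entries_lt ha'.
have sm : forall i, `|(ffconv n (rootpoly a) (rootpoly beta)).[g 0 i]| < e' ^+ n.
  by near: a.
set g' := Omega a beta.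
have ex i : exists k, `|g 0 i - g' 0 k| < e'.
  apply/existsP; apply: contraT; rewrite negb_exists => /forallP h.
  (* If all [n] factors were at least [e'] in absolute value, the product would be at least
     [e' ^+ n]. *)
  have := sm i; rewrite horner_ffconv_Omega // normr_prod ltNge.
  rewrite -[X in e' ^+ X](card_ord n) -prodr_const ler_prod // => k _.
  by rewrite ltW //= leNgt h.
pose s i := xchoose (ex i); have hs i : `|g 0 i - g' 0 (s i)| < e' := xchooseP (ex i).
have s_id : s =1 id.
  apply: ord_homo_id => i j ij; rewrite ltnNge; apply/negP => hle.
  have [[inc _] _] := Omega_spec beta ua'.
  have := inc _ _ hle; have := hd _ _ ij; have := hs i; have := hs j.
  rewrite -/g' !lt_min !ltr_norml => /andP[_ /andP[? ?]] /andP[_ /andP[? ?]] ? ?.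
  by lra.
by move=> k; have := hs k; rewrite s_id lt_min => /andP[].
Unshelve. all: by end_near. Qed.

Lemma diff_Omega_entry (R : realType) (n : nat) (alpha beta : 'rV[R]_n) (i : 'I_n) :
  (forall i j : 'I_n, (i < j)%N -> alpha 0 i < alpha 0 j) ->
  let g := Omega alpha beta in
  differentiable (fun a : 'rV[R]_n => Omega a beta 0 i) alpha /\
  forall j, 'D_(delta_mx 0 j) (fun a : 'rV[R]_n => Omega a beta 0 i) alpha =
   (ffconv n (prodX (rem (alpha 0 j) (entries alpha))) (rootpoly beta)).[g 0 i]
     / (rootpoly g)^`().[g 0 i].
Proof.
move=> ha g; have ua := uniq_entries_lt ha.
have [_ ug] := Omega_spec beta ua.
pose N (a : 'rV[R]_n) := (ffconv n (rootpoly a) (rootpoly beta)).[g 0 i].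
pose M (a : 'rV[R]_n) := \prod_(k | k != i) (g 0 i - Omega a beta 0 k).
(* Factoring at [g 0 i] gives [N a = (g 0 i - Omega a beta 0 i) * M a], hence this sign. *)
pose K a := - (M a)^-1.
have dN : differentiable N alpha by exact: differentiable_ffconv_horner.
have N0 : N alpha = 0.
  by rewrite /N horner_ffconv_Omega // (bigD1 i) //= subrr mul0r.
have Mg : M alpha = (rootpoly g)^`().[g 0 i].
  rewrite rootpolyE horner_deriv_prodX ?mem_entries // prodX_rem_entries.
  by rewrite horner_prod /M; apply: eq_bigr => k _; rewrite hornerXsubC.
have M0 : M alpha != 0.
  by rewrite Mg rootpolyE horner_deriv_prodX ?horner_prodX_rem_neq0 ?mem_entries.
have cM : M a @[a --> alpha] --> M alpha.
  apply: (@cvg_bigprod _ _ _ (nbhs alpha) _ _ _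
    (fun k a => g 0 i - Omega a beta 0 k)) => k; apply: cvgB; first exact: cvg_cst.
  apply/cvgrPdist_lt => e e0; have := @Omega_near R n alpha beta e ha e0.
  by apply: filterS => a; apply.
have cK : {for alpha, continuous K} by exact: cvgN (cvgV M0 cM).
have OE : \forall a \near alpha,
    Omega a beta 0 i = Omega alpha beta 0 i + N a * K a.
  near=> a.
  have ua' : uniq (entries a).
    by apply: uniq_entries_lt; near: a; exact: strict_near.
  have Ma : M a != 0 by near: a; exact: cvgr_neq0 cM M0.
  rewrite /N horner_ffconv_Omega // (bigD1 i) //= -/(M a) /K -/g.
  by field.
have [dO dOE] := is_diff_littleo_mul dN N0 cK OE.
split=> // j; rewrite deriveE // dOE -deriveE // derive_ffconv_horner /K Mg.
by rewrite mulrNN mulrC.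
Unshelve. all: by end_near. Qed.

(** * The entries of the Jacobian *)

Lemma constant_point_mass (R : realType) (n : nat) (a : 'rV[R]_n) :
  constant (entries a) -> point_mass n (rootpoly a).
Proof.
move=> /(constantP 0)[b eb]; exists b.
by rewrite rootpolyE eb size_entries big_nseq -Monoid.iteropE.
Qed.

Lemma coef_prodX (R : comNzRingType) (s : seq R) : (prodX s)`_(size s) = 1.
Proof.
have /monicP := monic_prod_XsubC s xpredT id.
by rewrite /lead_coef size_prod_XsubC.
Qed.

(** In the lowered degree both arguments are monic, so their top coefficients multiply to [1]; this
    is the value of the column sums. *)
Lemma coef_ffconv_prodX (R : realType) (s t : seq R) :
  size s = (size t).+1 -> (ffconv (size t).+1 (prodX t) (prodX s))`_(size t) = 1.
Proof.
move=> ss; rewrite ffconv_lower ?size_prod_XsubC // coefn_ffconv coef_prodX mul1r.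
by rewrite coefZ coef_deriv -ss coef_prodX mulVf // ss pnatr_eq0.
Qed.

Lemma sum_ffconv_rem (R : realType) (n : nat) (a : 'rV[R]_n) (q : {poly R}) :
  \sum_(j < n) ffconv n (prodX (rem (a 0 j) (entries a))) q =
  (ffconv n (rootpoly a) q)^`().
Proof.
rewrite deriv_ffconv; last by rewrite rootpolyE size_prod_XsubC size_entries.
by rewrite -ffconv_suml rootpolyE deriv_prodX [in RHS]big_map big_enum.
Qed.

(** Compare coefficients of degree [n] in the interpolation formula: each [prodX (rem x t)] is monic
    of that degree. *)
Lemma sum_lagrange_coef (R : realType) (n : nat) (g : 'rV[R]_n.+1) (p : {poly R}) :
  uniq (entries g) -> (size p <= n.+1)%N ->
  \sum_(i < n.+1) p.[g 0 i] / (rootpoly g)^`().[g 0 i] = p`_n.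
Proof.
move=> ug sp; rewrite {2}(lagrange (p := p) ug) ?size_entries // -rootpolyE.
rewrite coef_sum big_map big_enum; apply: eq_bigr => i _ /=.
have st : size (rem (g 0 i) (entries g)) = n.
  by rewrite size_rem ?mem_entries // size_entries.
by have := coef_prodX (rem (g 0 i) (entries g)); rewrite coefZ st => ->; rewrite mulr1.
Qed.

(** At a root of the convolution the positive Wronskian reduces to the product of numerator and
    denominator, which therefore have the same sign. *)
Lemma horner_ffconv_rem_gt0 (R : realType) (n : nat) (alpha beta : 'rV[R]_n.+1)
    (i j : 'I_n.+1) :
  uniq (entries alpha) -> ~ point_mass n.+1 (rootpoly beta) ->
  0 < (ffconv n.+1 (prodX (rem (alpha 0 j) (entries alpha)))
        (rootpoly beta)).[Omega alpha beta 0 i]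
    / (rootpoly (Omega alpha beta))^`().[Omega alpha beta 0 i].
Proof.
move=> ua hb; set g := Omega alpha beta; have [[_ eg] ug] := Omega_spec beta ua; rewrite -/g in eg.
set t := rem _ _.
have st : size t = n by rewrite size_rem ?mem_entries // size_entries.
have := @wronsk_ffconv_gt0 R n (entries beta) t (g 0 i) st (size_entries beta).
rewrite rem_uniq //= -!rootpolyE -(wronsk_ffconv_mulXsubC _ (alpha 0 j)).
rewrite -prodX_rem ?mem_entries // -rootpolyE eg /wronsk hornerD hornerN !hornerM.
have /rootP -> : root (rootpoly g) (g 0 i).
  by rewrite rootpolyE root_prod_XsubC mem_entries.
have -> : ~~ constant (entries beta) by apply/negP => /constant_point_mass.
rewrite mul0r subr0 => /(_ isT) h; rewrite mulrC.
have d0 : (rootpoly g)^`().[g 0 i] != 0.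
  by apply: contraTneq h => ->; rewrite mul0r ltxx.
set d := _.[_] in h d0 *; set u := _.[_] in h *.
have -> : d^-1 * u = d * u / d ^+ 2 by field.
by rewrite divr_gt0 // lt_def sqrf_eq0 d0 sqr_ge0.
Qed.

Theorem theorem5p1 (R : realType) (n : nat) (hn : (2 <= n)%N)
    (alpha beta : 'rV[R]_n)
    (halpha : forall i j : 'I_n, (i < j)%N -> alpha 0 i < alpha 0 j)
    (hbeta : ~ point_mass n (rootpoly beta)) :
  [/\ increasing_roots (ffconv n (rootpoly alpha) (rootpoly beta))
        (Omega alpha beta),
      forall i : 'I_n,
        mup (Omega alpha beta 0 i)
          (ffconv n (rootpoly alpha) (rootpoly beta)) = 1%N,
      differentiable (fun a : 'rV[R]_n => Omega a beta) alpha,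
      doubly_stochastic (D1Omega alpha beta)
    & forall i j : 'I_n, 0 < D1Omega alpha beta i j].
Proof.
have ua := uniq_entries_lt halpha.
have [[inc eg] ug] := Omega_spec beta ua.
have dO : differentiable (fun a : 'rV[R]_n => Omega a beta) alpha.
  by apply: differentiable_row => i; have [] := diff_Omega_entry beta i halpha.
case: n hn alpha beta halpha hbeta ua inc eg ug dO => [//|n] _ alpha beta halpha.
move=> hbeta ua inc; set g := Omega alpha beta in inc * => eg ug dO.
have EE i j : D1Omega alpha beta i j =
    (ffconv n.+1 (prodX (rem (alpha 0 j) (entries alpha))) (rootpoly beta)).[g 0 i]
      / (rootpoly g)^`().[g 0 i].
  rewrite mxE jacobian_row //.
  by have [_] := diff_Omega_entry beta i halpha; apply.
have E0 i j : 0 < D1Omega alpha beta i j by rewrite EE horner_ffconv_rem_gt0.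
split=> //.
- by move=> i; rewrite eg rootpolyE mu_prod_XsubC count_uniq_mem // mem_entries.
- split=> [i j|i|j]; first exact: ltW.
    (* Row sums: the numerators add up to the common denominator, which is nonzero at a simple
       root. *)
    under eq_bigr do rewrite EE; rewrite -mulr_suml -horner_sum sum_ffconv_rem eg.
    rewrite divff // rootpolyE horner_deriv_prodX ?mem_entries //.
    by rewrite horner_prodX_rem_neq0 ?mem_entries.
  (* Column sums: the interpolation nodes are the roots [g], and the sum is the coefficient of
     degree [n] of the convolved polynomial. *)
  under eq_bigr do rewrite EE; set t := rem _ _.
  have st : size t = n by rewrite size_rem ?mem_entries // size_entries.
  have sb : size (entries beta) = (size t).+1 by rewrite st size_entries.
  rewrite sum_lagrange_coef //.
    by have := coef_ffconv_prodX sb; rewrite st -rootpolyE.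
  rewrite ffconv_lower ?size_ffconv //.
  by rewrite size_prod_XsubC st.
Qed.
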